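(* The semi-discrete (continuous-in-time) discontinuous Galerkin scheme for the Vlasov equation described in the context conserves the total number of particles: for the solution $f_h$ of the scheme (for each species), $$\frac{d}{dt}\sum_j\int_{K_j}f_h\,d\mathbf{z}=0,$$ the sum being over all phase-space cells.
   Context: Phase space is $K=\Omega\times V$ with configuration space $\Omega\subset\mathbb{R}^3$ and velocity space $V\subset\mathbb{R}^3$ (boxes), points $\mathbf{z}=(\mathbf{x},\mathbf{v})$, and $\nabla_{\mathbf{z}}=(\nabla_{\mathbf{x}},\nabla_{\mathbf{v}})$. $\mathcal{T}$ is a Cartesian mesh of $K$ with finitely many cells $K_j$, each a product of a configuration-space cell and a velocity-space cell. Let $\mathbf{P}^p$ be a fixed finite-dimensional space of polynomials in $\mathbf{z}$ containing the constants (in the intended scheme, the Serendipity space of order $p$), and $\mathcal{V}_h^p=\{v: v|_{K_j}\in\mathbf{P}^p\ \forall K_j\in\mathcal{T}\}$. On a face of a cell, superscript $-$ (resp. $+$) denotes the trace from just inside (resp. just outside) the cell. For a species with charge $q$ and mass $m>0$, the discrete distribution function $f_h(t,\cdot)\in\mathcal{V}_h^p$ is differentiable in $t$ and satisfies, for all cells $K_j$ and all $w\in\mathcal{V}_h^p$, $$\int_{K_j}w\,\partial_t f_h\,d\mathbf{z}+\oint_{\partial K_j}w^-\,\mathbf{n}\cdot\hat{\mathbf{F}}\,dS-\int_{K_j}\nabla_{\mathbf{z}}w\cdot\boldsymbol{\alpha}_hf_h\,d\mathbf{z}=0,$$ where $\boldsymbol{\alpha}_h=\big(\mathbf{v},\tfrac{q}{m}(\mathbf{E}_h+\mathbf{v}\times\mathbf{B}_h)\big)$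 with $\mathbf{E}_h(t,\mathbf{x}),\mathbf{B}_h(t,\mathbf{x})$ the discrete electric and magnetic fields (piecewise polynomial in $\mathbf{x}$ on the induced mesh of $\Omega$), $\mathbf{n}$ is the outward unit normal of $K_j$, and $\mathbf{n}\cdot\hat{\mathbf{F}}$ is the local Lax–Friedrichs flux $$\mathbf{n}\cdot\hat{\mathbf{F}}=\tfrac12\mathbf{n}\cdot(\boldsymbol{\alpha}_h^+f_h^++\boldsymbol{\alpha}_h^-f_h^-)-\tfrac{\lambda}{2}(f_h^+-f_h^-),\qquad\lambda=\max(|\mathbf{n}\cdot\boldsymbol{\alpha}_h^+|,|\mathbf{n}\cdot\boldsymbol{\alpha}_h^-|).$$ All integrals are evaluated exactly. Boundary conditions: in configuration space, either $\Omega$ is periodic or $f_h$ vanishes on $\partial\Omega\times V$ and the numerical flux is zero there; the numerical flux $\mathbf{n}\cdot\hat{\mathbf{F}}$ is zero on $\Omega\times\partial V$. *)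

(* Defs.v *)
From HB Require Import structures.
From mathcomp Require Import all_boot all_order all_algebra.
From mathcomp Require Import all_classical all_reals all_analysis.
(* The notations of mpoly clash with those of MathComp-Analysis. *)
From mathcomp Require mpoly.
Export -(notations) mpoly.

Set Implicit Arguments.
Unset Strict Implicit.
Unset Printing Implicit Defensive.

Import Order.TTheory GRing.Theory Num.Theory numFieldNormedType.Exports.

Local Open Scope classical_set_scope.
Local Open Scope ring_scope.

Section Integration.
Context {R : realType}.
Local Notation Rb := (measurableTypeR R).

Definition tcons n (p : n.-tuple Rb * Rb) : n.+1.-tuple Rb :=
  [tuple of p.2 :: p.1].

Lemma measurable_tcons n : measurable_fun [set: n.-tuple Rb * Rb] (@tcons n).
Proof. exact: measurable_cons. Qed.

(* The pushforward of mu \x lebesgue_measure by tcons, as a measure. *)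
Definition leb_step n (mu : {measure set (n.-tuple Rb) -> \bar R}) :
    {measure set (n.+1.-tuple Rb) -> \bar R} :=
  measure_function_pushforward__canonical__measure_function_Measure
    (mu \x lebesgue_measure)%E (@measurable_tcons n).

(* n-dimensional Lebesgue measure. *)
Fixpoint leb n : {measure set (n.-tuple Rb) -> \bar R} :=
  match n with
  | 0 => dirac [tuple]
  | n'.+1 => leb_step (leb n')
  end.

Definition row_of_tuple n (y : n.-tuple Rb) : 'rV[R]_n := \row_i tnth y i.

Definition obox n (lo hi : 'rV[R]_n) : set 'rV[R]_n :=
  [set z | forall d, lo 0 d < z 0 d < hi 0 d].

Definition box_integral n (lo hi : 'rV[R]_n) (g : 'rV[R]_n -> R) : R :=
  \int[leb n]_(y in [set y | obox lo hi (row_of_tuple y)]) g (row_of_tuple y).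

Definition insert_coord n (d : 'I_n.+1) (c : R) (y : 'rV[R]_n) : 'rV[R]_n.+1 :=
  \row_i (if unlift d i is Some k then y 0 k else c).

(* Surface integral over the part of the hyperplane z_d = c whose other
   coordinates lie between those of lo and hi. *)
Definition face_integral n (d : 'I_n.+1) (c : R) (lo hi : 'rV[R]_n.+1)
    (g : 'rV[R]_n.+1 -> R) : R :=
  box_integral (col' d lo : 'rV[R]_n) (col' d hi : 'rV[R]_n)
    (fun y => g (insert_coord d c y)).

End Integration.

Section Vectors.
Context {R : realType}.

Definition dot n (u v : 'rV[R]_n) : R := \sum_i u 0 i * v 0 i.

(* Indices are in 'I_3, hence taken modulo 3. *)
Definition cross (u v : 'rV[R]_3) : 'rV[R]_3 :=
  \row_i (u 0 (i + 1) * v 0 (i + 2) - u 0 (i + 2) * v 0 (i + 1)).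

Definition gradient n (w : 'rV[R]_n -> R) (z : 'rV[R]_n) : 'rV[R]_n :=
  \row_d 'D_(delta_mx 0 d) w z.

(* One-sided trace at z, from the side towards which u points. *)
Definition trace n (U : ptopologicalType) (g : 'rV[R]_n -> U) (z u : 'rV[R]_n) : U :=
  lim (g (z + h *: u) @[h --> 0^'+]).

End Vectors.

Definition finite_dim_space (R : realType) n (P : set (mpoly n R)) : Prop :=
  exists (k : nat) (b : 'I_k -> mpoly n R),
    P = [set p | exists c : 'I_k -> R, p = \sum_i c i *: b i].

(* Tensor-product grid, possibly non-uniform: in direction d the nodes are
   node d 0 < ... < node d (ncell d). *)
Record mesh (R : realType) (n : nat) := Mesh {
  ncell : 'I_n -> nat ;
  node : 'I_n -> nat -> R ;
  ncell_gt0 : forall d, (0 < ncell d)%N ;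
  node_lt : forall d i, (i < ncell d)%N -> node d i < node d i.+1
}.

Section Mesh.
Context {R : realType} {n : nat} (T : mesh R n).

Definition cell := {dffun forall d : 'I_n, 'I_(ncell T d)}.
Definition cell_lo (j : cell) : 'rV[R]_n := \row_d node T d (j d).
Definition cell_hi (j : cell) : 'rV[R]_n := \row_d node T d (j d).+1.
Definition dom_lo : 'rV[R]_n := \row_d node T d 0.
Definition dom_hi : 'rV[R]_n := \row_d node T d (ncell T d).

Definition piecewise_polynomial (g : 'rV[R]_n -> R) : Prop :=
  forall j : cell, exists p : mpoly n R,
    forall x, obox (cell_lo j) (cell_hi j) x -> g x = meval (x 0) p.

End Mesh.

(* Points of phase space are z = (x, v), with x = lsubmx z and v = rsubmx z. *)
Section PhaseSpace.
Context {R : realType} (Tx Tv : mesh R 3).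
Local Notation phase := 'rV[R]_(3 + 3).

Definition pcell := (cell Tx * cell Tv)%type.
Definition lo (j : pcell) : phase := row_mx (cell_lo j.1) (cell_lo j.2).
Definition hi (j : pcell) : phase := row_mx (cell_hi j.1) (cell_hi j.2).
Definition Klo : phase := row_mx (dom_lo Tx) (dom_lo Tv).
Definition Khi : phase := row_mx (dom_hi Tx) (dom_hi Tv).

(* Elements of the discrete space may be multi-valued on cell interfaces, so
   only their values in the open cells are constrained. *)
Definition in_Vh (P : set (mpoly (3 + 3) R)) (v : phase -> R) : Prop :=
  forall j, exists2 p, P p &
    forall z, obox (lo j) (hi j) z -> v z = meval (z 0) p.

Definition cell_integral (j : pcell) (g : phase -> R) : R :=
  box_integral (lo j) (hi j) g.

(* Each cell has twelve faces, indexed by a direction d and a side s, with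
   s = true for the face of larger d-th coordinate. *)
Definition normal (d : 'I_(3 + 3)) (s : bool) : phase :=
  (if s then 1 else -1) *: delta_mx 0 d.

Definition face_coord (j : pcell) (d : 'I_(3 + 3)) (s : bool) : R :=
  (if s then hi j else lo j) 0 d.

Definition face (j : pcell) (d : 'I_(3 + 3)) (s : bool) : set phase :=
  [set z | z 0 d = face_coord j d s /\
           forall k, k != d -> lo j 0 k < z 0 k < hi j 0 k].

Definition boundary_integral (j : pcell)
    (g : 'I_(3 + 3) -> bool -> phase -> R) : R :=
  \sum_d \sum_s
    @face_integral R 5 d (face_coord j d s) (lo j) (hi j) (g d s).

Definition on_boundary (d : 'I_(3 + 3)) (s : bool) (z : phase) : bool :=
  z 0 d == (if s then Khi else Klo) 0 d.

Definition config_dir (d : 'I_(3 + 3)) : bool := (d < 3)%N.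

Definition inner_trace (U : ptopologicalType) (g : phase -> U)
    (d : 'I_(3 + 3)) (s : bool) (z : phase) : U :=
  trace g z (- normal d s).

(* On the boundary of K the outer trace is taken through the periodic
   identification of z with the corresponding point of the opposite face. *)
Definition outer_trace (U : ptopologicalType) (g : phase -> U)
    (d : 'I_(3 + 3)) (s : bool) (z : phase) : U :=
  let z' := if on_boundary d s z
            then z - (Khi 0 d - Klo 0 d) *: normal d s else z in
  trace g z' (normal d s).

Definition alpha (q m : R) (E B : 'rV[R]_3 -> 'rV[R]_3) (z : phase) : phase :=
  let x := lsubmx z in
  let v := rsubmx z in
  row_mx v ((q / m) *: (E x + cross v (B x))).

Definition lax_friedrichs (nu aP aM : phase) (fP fM : R) : R :=
  let lambda := Num.max `|dot nu aP| `|dot nu aM| in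
  2^-1 * dot nu (fP *: aP + fM *: aM) - lambda / 2 * (fP - fM).

(* n . F^ on the face of outward normal `normal d s`.  It is zero on the
   boundary of V and, unless Omega is periodic, on the boundary of Omega. *)
Definition num_flux (periodic : bool) (a : phase -> phase) (f : phase -> R)
    (d : 'I_(3 + 3)) (s : bool) (z : phase) : R :=
  if on_boundary d s z && ~~ (config_dir d && periodic) then 0
  else lax_friedrichs (normal d s)
         (outer_trace a d s z) (inner_trace a d s z)
         (outer_trace (f : phase -> R^o) d s z)
         (inner_trace (f : phase -> R^o) d s z).

Definition dg_scheme (P : set (mpoly (3 + 3) R)) (periodic : bool) (q m : R)
    (E B : R -> 'rV[R]_3 -> 'rV[R]_3) (f : R -> phase -> R) (t : R) : Prop :=
  let a := alpha q m (E t) (B t) in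
  forall (j : pcell) (w : phase -> R), in_Vh P w ->
    cell_integral j (fun z => w z * derive1 (fun s => f s z) t)
    + boundary_integral j (fun d s z =>
        inner_trace (w : phase -> R^o) d s z * num_flux periodic a (f t) d s z)
    - cell_integral j (fun z => dot (gradient w z) (f t z *: a z)) = 0.

Definition vanishes_on_config_boundary (f : phase -> R) : Prop :=
  forall (j : pcell) d s z, config_dir d -> face j d s z -> on_boundary d s z ->
    inner_trace (f : phase -> R^o) d s z = 0.

Definition particle_number (f : phase -> R) : R :=
  \sum_(j : pcell) cell_integral j f.

End PhaseSpace.

(* Main.v *)
Require Import Defs.
From mathcomp Require Import all_boot all_order all_algebra.
From mathcomp Require Import all_classical all_reals all_analysis.
Import Order.TTheory GRing.Theory Num.Theory numFieldNormedType.Exports.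

Local Open Scope classical_set_scope.
Local Open Scope ring_scope.

(* Test the scheme with w = 1: the volume term drops and the rate of change of
   the mass of a cell is minus its boundary flux.  In each direction the upper
   face of a cell is the lower face of the next one, cyclically; there the
   fluxes of the two cells are opposite, and at the wrap-around this holds by
   periodicity or because both vanish.  Hence the boundary fluxes cancel in the
   sum over cells.  The time derivative commutes with the integral because f
   lies in a finite-dimensional space, so that its integral is a fixed linear
   combination of finitely many point values. *)

(** * Sign rules for the Lax-Friedrichs flux and for integrals *)

Lemma dotNl {R : realType} n (u v : 'rV[R]_n) : dot (- u) v = - dot u v.
Proof. by rewrite /dot -sumrN; apply: eq_bigr => i _; rewrite mxE mulNr. Qed.

(** The average is symmetric in the two states and linear in the normal, the jump is odd in the
    states, and [lambda] is unchanged: so the flux is conservative. *)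
Lemma lax_friedrichsN {R : realType} (nu aP aM : 'rV[R]_(3 + 3)) (fP fM : R) :
  lax_friedrichs (- nu) aM aP fM fP = - lax_friedrichs nu aP aM fP fM.
Proof.
rewrite /lax_friedrichs !dotNl !normrN maxC (addrC (fM *: aM)).
by rewrite mulrN -(opprB fP) [X in _ - X]mulrN opprD.
Qed.

Lemma normal_false {R : realType} d :
  normal d false = - normal d true :> 'rV[R]_(3 + 3).
Proof. by rewrite /normal scaleNr. Qed.

Lemma box_integral_congr {R : realType} {n} {lo hi : 'rV[R]_n}
    {g h : 'rV[R]_n -> R} :
  (forall z, obox lo hi z -> g z = h z) ->
  box_integral lo hi g = box_integral lo hi h.
Proof. by move=> gh; apply: eq_Rintegral => y; rewrite inE => /gh. Qed.

(* Holds without integrability: an infinite integral has real part 0, and so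
   does oo - oo. *)
Lemma Rintegral_opp d {T : measurableType d} {R : realType}
    (mu : {measure set T -> \bar R}) (D : set T) (g : T -> R) :
  \int[mu]_(x in D) (- g x) = - \int[mu]_(x in D) g x.
Proof.
rewrite /Rintegral (integralE mu D (fun x => (g x)%:E)).
rewrite (integralE mu D (fun x => (- g x)%:E)).
rewrite (_ : (fun x => (- g x)%:E) = (\- (fun x => (g x)%:E))%E) //.
rewrite funeposN funenegN; set p := integral _ _ _^\+%E.
set q := integral _ _ _^\-%E.
have : (0 <= p)%E by exact: integral_ge0.
have : (0 <= q)%E by exact: integral_ge0.
by move: p q => [p| |] [q| |] //= _ _; rewrite ?oppr0 // opprB.
Qed.

Lemma box_integralN {R : realType} n (lo hi : 'rV[R]_n) (g : 'rV[R]_n -> R) :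
  box_integral lo hi (fun z => - g z) = - box_integral lo hi g.
Proof. exact: Rintegral_opp. Qed.

(** * Cyclic neighbours in a tensor-product grid *)

Section Neighbours.
Context {R : realType} {n : nat} {T : mesh R n}.

Lemma node_lt_mono d i k : (i < k)%N -> (k <= ncell T d)%N ->
  node T d i < node T d k.
Proof.
elim: k => // k IH; rewrite ltnS leq_eqVlt => /predU1P[->|ik] kn.
  exact: node_lt.
by apply: lt_trans (node_lt kn); exact: IH (ltnW kn).
Qed.

(** [ordS] is the cyclic successor: the last cell is followed by the first, also when the domain is
    not periodic. This makes the map a permutation of the cells. *)
Definition next_cell (d : 'I_n) (j : cell T) : cell T :=
  [ffun k => if k == d then ordS (j k) else j k].

Lemma next_cell_inj d : injective (next_cell d).
Proof.
move=> i j /ffunP ij; apply/ffunP => k; have := ij k; rewrite !ffunE.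
by case: eqP => // _ /(can_inj (@ordSK _)).
Qed.

Lemma next_cell_lo d j k : k != d -> cell_lo (next_cell d j) 0 k = cell_lo j 0 k.
Proof. by move=> kd; rewrite !mxE ffunE (negbTE kd). Qed.

Lemma next_cell_hi d j k : k != d -> cell_hi (next_cell d j) 0 k = cell_hi j 0 k.
Proof. by move=> kd; rewrite !mxE ffunE (negbTE kd). Qed.

(** Either the shared face is interior, with strict bounds that rule out [on_boundary], or [j] is
    the last cell in direction [d] and its successor wraps around. *)
Lemma next_cell_face d (j : cell T) :
  (cell_hi j 0 d = cell_lo (next_cell d j) 0 d /\
    dom_lo T 0 d < cell_hi j 0 d < dom_hi T 0 d) \/
  (cell_hi j 0 d = dom_hi T 0 d /\ cell_lo (next_cell d j) 0 d = dom_lo T 0 d).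
Proof.
rewrite !mxE ffunE eqxx /=; have := ltn_ord (j d).
rewrite leq_eqVlt => /predU1P[->|jn]; [right|left].
  by rewrite modnn.
by rewrite modn_small // !node_lt_mono // ltnW.
Qed.

End Neighbours.

(** * Cancellation of the boundary fluxes of neighbouring phase-space cells *)

Section PhaseNeighbours.
Context {R : realType} {Tx Tv : mesh R 3}.

Definition next_pcell (d : 'I_(3 + 3)) (j : pcell Tx Tv) : pcell Tx Tv :=
  match fintype.split d with
  | inl d => (next_cell d j.1, j.2)
  | inr d => (j.1, next_cell d j.2)
  end.

Lemma next_pcell_inj d : injective (next_pcell d).
Proof.
rewrite /next_pcell => -[i1 i2] [j1 j2].
by case: fintype.split => c /= [] => [/next_cell_inj -> ->|-> /next_cell_inj ->].
Qed.

Lemma next_pcell_lo d j k : k != d -> lo (next_pcell d j) 0 k = lo j 0 k.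
Proof.
rewrite /next_pcell; case: (split_ordP d) => c -> kc;
  case: (split_ordP k) kc => e -> //; rewrite /lo ?row_mxEl ?row_mxEr //=;
  rewrite ?(inj_eq (@lshift_inj _ _)) ?(inj_eq (@rshift_inj _ _)) => ec;
  by rewrite next_cell_lo.
Qed.

Lemma next_pcell_hi d j k : k != d -> hi (next_pcell d j) 0 k = hi j 0 k.
Proof.
rewrite /next_pcell; case: (split_ordP d) => c -> kc;
  case: (split_ordP k) kc => e -> //; rewrite /hi ?row_mxEl ?row_mxEr //=;
  rewrite ?(inj_eq (@lshift_inj _ _)) ?(inj_eq (@rshift_inj _ _)) => ec;
  by rewrite next_cell_hi.
Qed.

Lemma next_pcell_face d (j : pcell Tx Tv) :
  (hi j 0 d = lo (next_pcell d j) 0 d /\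
    Klo Tx Tv 0 d < hi j 0 d < Khi Tx Tv 0 d) \/
  (hi j 0 d = Khi Tx Tv 0 d /\ lo (next_pcell d j) 0 d = Klo Tx Tv 0 d).
Proof.
rewrite /next_pcell /lo /hi /Klo /Khi.
by case: (split_ordP d) => c ->; rewrite ?row_mxEl ?row_mxEr; exact: next_cell_face.
Qed.

Lemma insert_coordE d (c : R) (y : 'rV[R]_5) : insert_coord d c y 0 d = c.
Proof. by rewrite mxE unlift_none. Qed.

Lemma insert_coordD d (a b : R) (y : 'rV[R]_5) :
  insert_coord d a y + b *: delta_mx 0 d = insert_coord d (a + b) y.
Proof.
apply/rowP => i; rewrite !mxE eqxx /=.
case: unliftP => [k|] -> /=; last by rewrite eqxx mulr1.
by rewrite eq_sym (negbTE (neq_lift _ _)) mulr0 addr0.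
Qed.

Lemma num_flux_antisym (periodic : bool) (a : 'rV[R]_(3 + 3) -> 'rV[R]_(3 + 3))
    (f : 'rV[R]_(3 + 3) -> R) d (j : pcell Tx Tv) (y : 'rV[R]_5) :
  num_flux Tx Tv periodic a f d false
    (insert_coord d (lo (next_pcell d j) 0 d) y) =
  - num_flux Tx Tv periodic a f d true (insert_coord d (hi j 0 d) y).
Proof.
rewrite /num_flux /on_boundary !insert_coordE.
case: (next_pcell_face d j) => [[<- /andP[lt1 lt2]]|[-> ->]].
  (* Interior face: both fluxes are taken at the same point, and the inner trace of one cell is the
     outer trace of the other. *)
  rewrite (gt_eqF lt1) (lt_eqF lt2) /=.
  rewrite /outer_trace /inner_trace /on_boundary !insert_coordE.
  by rewrite (gt_eqF lt1) (lt_eqF lt2) /= normal_false opprK lax_friedrichsN.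
(* Wrap-around: both fluxes are set to zero, unless [d] is a configuration direction and the domain
   is periodic. *)
rewrite !eqxx !andTb; case: (~~ _); first by rewrite oppr0.
rewrite /outer_trace /inner_trace /on_boundary !insert_coordE !eqxx /=.
rewrite normal_false opprK lax_friedrichsN.
(* The translation by one period in [outer_trace] carries each of the two opposite points to the
   other, so the traces are again exchanged. *)
have -> : insert_coord d (Klo Tx Tv 0 d) y -
    (Khi Tx Tv 0 d - Klo Tx Tv 0 d) *: - normal d true =
    insert_coord d (Khi Tx Tv 0 d) y.
  by rewrite /normal scale1r scalerN opprK insert_coordD subrKC.
have -> : insert_coord d (Khi Tx Tv 0 d) y -
    (Khi Tx Tv 0 d - Klo Tx Tv 0 d) *: normal d true =
    insert_coord d (Klo Tx Tv 0 d) y.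
  by rewrite /normal scale1r -scaleNr opprB insert_coordD subrKC.
by [].
Qed.

Lemma face_integral_next (periodic : bool)
    (a : 'rV[R]_(3 + 3) -> 'rV[R]_(3 + 3)) (f : 'rV[R]_(3 + 3) -> R) d
    (j : pcell Tx Tv) :
  let k := next_pcell d j in
  @face_integral R 5 d (face_coord k d false) (lo k) (hi k)
    (num_flux Tx Tv periodic a f d false) =
  - @face_integral R 5 d (face_coord j d true) (lo j) (hi j)
    (num_flux Tx Tv periodic a f d true).
Proof.
move=> k; rewrite /face_integral -box_integralN.
have -> : col' d (lo k : 'rV_5.+1) = col' d (lo j : 'rV_5.+1).
  apply/rowP => i; rewrite [LHS]mxE [RHS]mxE; apply: next_pcell_lo.
  by rewrite eq_sym neq_lift.
have -> : col' d (hi k : 'rV_5.+1) = col' d (hi j : 'rV_5.+1).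
  apply/rowP => i; rewrite [LHS]mxE [RHS]mxE; apply: next_pcell_hi.
  by rewrite eq_sym neq_lift.
by apply: box_integral_congr => y _; exact: num_flux_antisym.
Qed.

Lemma sum_boundary_flux (periodic : bool)
    (a : 'rV[R]_(3 + 3) -> 'rV[R]_(3 + 3)) (f : 'rV[R]_(3 + 3) -> R) :
  \sum_(j : pcell Tx Tv) boundary_integral j (num_flux Tx Tv periodic a f) = 0.
Proof.
rewrite /boundary_integral exchange_big big1 //= => d _.
pose F s (j : pcell Tx Tv) := @face_integral R 5 d (face_coord j d s)
  (lo j) (hi j) (num_flux Tx Tv periodic a f d s).
have FN j : F false (next_pcell d j) = - F true j by exact: face_integral_next.
rewrite (eq_bigr (fun j => F true j + F false j)) => [|j _]; last first.
  by rewrite big_bool.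
(* Reindexing the lower faces by the successor pairs each of them with the upper face of the
   preceding cell. *)
rewrite big_split /= [X in _ + X](reindex_inj (@next_pcell_inj d)).
by rewrite [X in _ + X](eq_bigr _ (fun j _ => FN j)) sumrN subrr.
Qed.

End PhaseNeighbours.

(** * Integrals of polynomials over boxes *)

Lemma meval_sumZ {R : comNzRingType} n k (v : 'I_n -> R) (c : 'I_k -> R)
    (p : 'I_k -> mpoly n R) :
  meval v (\sum_(i < k) c i *: p i) = \sum_(i < k) c i * meval v (p i).
Proof. by rewrite raddf_sum; apply: eq_bigr => i _ /=; rewrite mevalZ. Qed.

Section BoxIntegral.
Context {R : realType}.

Lemma measurable_obox n (lo hi : 'rV[R]_n) :
  measurable [set y : n.-tuple (measurableTypeR R) | obox lo hi (row_of_tuple y)].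
Proof.
rewrite (_ : [set _ | _] =
    \bigcap_(i in [set: 'I_n]) ((fun y => tnth y i) @^-1` `]lo 0 i, hi 0 i[)).
  apply: fin_bigcap_measurable => [|i _]; first exact: finite_finset.
  by rewrite -[_ @^-1` _]setTI; exact: measurable_tnth.
apply/seteqP; split => y /= yb i; first by have := yb i; rewrite mxE /= in_itv.
by have := yb i I; rewrite /= in_itv mxE.
Qed.

Lemma leb_obox_lty n (lo hi : 'rV[R]_n) :
  (leb n [set y | obox lo hi (row_of_tuple y)] < +oo)%E.
Proof.
elim: n lo hi => [|n IH] lo hi.
  by rewrite /= diracE; case: (_ \in _); rewrite ltry.
have [lo' Elo] : exists lo' : 'rV[R]_n, forall i, lo' 0 i = lo 0 (lift ord0 i).
  by exists (\row_i lo 0 (lift ord0 i)) => i; rewrite mxE.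
have [hi' Ehi] : exists hi' : 'rV[R]_n, forall i, hi' 0 i = hi 0 (lift ord0 i).
  by exists (\row_i hi 0 (lift ord0 i)) => i; rewrite mxE.
rewrite /= /pushforward.
(* [leb] is a pushforward of a product measure along [tcons], which puts the second factor at the
   head of the tuple; so the first coordinate gives the interval on the right. *)
rewrite (_ : _ @^-1` _ = [set y | obox lo' hi' (row_of_tuple y)] `*`
                         `]lo 0 0, hi 0 0[%classic); last first.
  apply/seteqP; split => -[y c] /=.
    move=> yb; split => [i|].
      by have := yb (lift ord0 i); rewrite !mxE Elo Ehi tnthS.
    by have := yb ord0; rewrite mxE tnth0 in_itv.
  rewrite in_itv /= => -[yb cb] i; rewrite mxE.
  by case: (unliftP ord0 i) => [k|] ->; rewrite ?tnth0 // tnthS -Elo -Ehi;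
    have := yb k; rewrite mxE.
rewrite product_measure1E //; last exact: measurable_obox.
rewrite lte_mul_pinfty //.
  by rewrite fin_numElt IH (lt_le_trans _ (measure_ge0 _ _)).
suff : (lebesgue_measure `]lo ord0 ord0, hi ord0 ord0[%classic < +oo)%E by [].
by rewrite lebesgue_measure_itv /=; case: ifP; rewrite ?ltry // EFinN -EFinB ltry.
Qed.

Lemma meval_integrable n (lo hi : 'rV[R]_n) (p : mpoly n R) :
  (leb n).-integrable [set y | obox lo hi (row_of_tuple y)]
    (EFin \o (fun y => meval (row_of_tuple y 0) p)).
Proof.
apply: measurable_bounded_integrable.
- exact: measurable_obox.
- exact: leb_obox_lty.
- rewrite (_ : (fun y => _) = fun y : n.-tuple (measurableTypeR R) =>
      \sum_(m <- msupp p) mcoeff m p * \prod_(i < n) tnth y i ^+ m i).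
    apply: measurable_sum => m; apply: measurable_realfun.measurable_funM => //.
    apply: measurable_prod => i _; apply: measurable_realfun.measurable_funX.
    apply: measurable_funTS; exact: measurable_tnth.
  apply/funext => y; rewrite mevalE; apply: eq_bigr => m _.
  by congr (_ * _); apply: eq_bigr => i _; rewrite mxE.
(* [M i] bounds the i-th coordinate in absolute value on the box; the triangle inequality over the
   monomials then bounds the polynomial. *)
- pose M i := Num.max `|lo 0 i| `|hi 0 i|.
  exists (\sum_(m <- msupp p) `|mcoeff m p| * \prod_(i < n) M i ^+ m i).
  split; first exact: num_real.
  move=> r /ltW rM y yb /=; apply: le_trans rM; rewrite mevalE.
  apply: le_trans (ler_norm_sum _ _ _) _; apply: ler_sum => m _.
  rewrite normrM ler_wpM2l // normr_prod; apply: ler_prod => i _.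
  rewrite normr_ge0 normrX lerXn2r ?nnegrE //.
    by rewrite /M le_max normr_ge0.
  have /andP[lo_y y_hi] := yb i; rewrite /M le_max.
  have [y0|y0] := leP 0 (row_of_tuple y 0 i); apply/orP; [right|left].
    by rewrite !ger0_norm ?(ltW y_hi) // (le_trans y0 (ltW y_hi)).
  by rewrite !ltr0_norm ?(lt_trans lo_y) // lerN2 (ltW lo_y).
Qed.

(** Additivity of the integral requires integrable summands; the head and the tail of the sum are
    both values of a polynomial, hence integrable on the box. *)
Lemma box_integral_meval_sum n (lo hi : 'rV[R]_n) k (c : 'I_k -> R)
    (p : 'I_k -> mpoly n R) :
  box_integral lo hi (fun z => \sum_(i < k) c i * meval (z 0) (p i)) =
  \sum_(i < k) c i * box_integral lo hi (fun z => meval (z 0) (p i)).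
Proof.
have mB := @measurable_obox n lo hi.
have intp := @meval_integrable n lo hi.
elim: k c p => [|k IH] c p.
  rewrite big_ord0 /box_integral; under eq_Rintegral do rewrite big_ord0.
  by rewrite Rintegral_cst // mul0r.
rewrite big_ord_recl -IH /box_integral.
under eq_Rintegral do rewrite big_ord_recl.
rewrite RintegralD // ?RintegralZl //.
  have := intp (c ord0 *: p ord0); congr integrable.
  by apply/funext => y /=; rewrite mevalZ.
have := intp (\sum_(i < k) c (lift ord0 i) *: p (lift ord0 i)).
by congr integrable; apply/funext => y /=; rewrite meval_sumZ.
Qed.

End BoxIntegral.

(** * Sampling in a finite-dimensional space and differentiation under the integral *)

(* When adding a generator b to the span, either b is already reproduced on X,
   or a point where the remainder b - sum_k b(z_k) phi_k does not vanish is a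
   new sample. *)
Lemma polynomial_sampling {R : realType} {n} (X : set 'rV[R]_n) {k}
    (b : 'I_k -> mpoly n R) :
  exists (r : nat) (z : 'I_r -> 'rV[R]_n) (phi : 'I_r -> mpoly n R),
    (forall i, X (z i)) /\
    forall j x, X x ->
      meval (x 0) (b j) = \sum_(i < r) meval (z i 0) (b j) * meval (x 0) (phi i).
Proof.
elim: k b => [|k IH] b.
  by exists 0%N, (fun=> 0), (fun=> 0); split=> [[]|[]].
have [r [z [phi [Xz zphi]]]] := IH (fun j => b (lift ord0 j)).
pose b0 := b ord0.
pose rem := b0 - \sum_(i < r) meval (z i 0) b0 *: phi i.
have remE (x : 'rV_n) : meval (x 0) rem =
    meval (x 0) b0 - \sum_(i < r) meval (z i 0) b0 * meval (x 0) (phi i).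
  by rewrite /rem mevalB meval_sumZ.
have [rem0|/existsNP[y /not_implyP[Xy /eqP remy]]] :=
    pselect (forall x, X x -> meval (x 0) rem = 0).
  exists r, z, phi; split=> // j x Xx.
  case: (unliftP ord0 j) => [i|] ->; first exact: zphi.
  by apply/eqP; rewrite -subr_eq0 -remE rem0.
(* Normalised to take the value 1 at the new sample [y]. *)
pose psi := (meval (y 0) rem)^-1 *: rem.
exists r.+1, (fun i => if unlift ord0 i is Some l then z l else y),
  (fun i => if unlift ord0 i is Some l
            then phi l - meval (y 0) (phi l) *: psi else psi).
split=> [i|j x Xx]; first by case: unliftP.
rewrite big_ord_recl unlift_none.
under eq_bigr do rewrite liftK mevalB mevalZ mulrBr mulrA.
(* Regrouped, the new formula is the old one plus [psi] times the old error at [y]. That error is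
   zero for the old generators; for [b0] it is the value of [rem] at [y], and its product with [psi]
   is [rem]. *)
rewrite sumrB -mulr_suml addrCA -mulrBl.
rewrite mevalZ; case: (unliftP ord0 j) => [i|] ->.
  by rewrite -!zphi // subrr mul0r addr0.
by rewrite -/b0 -remE mulVKf // remE subrKC.
Qed.

Lemma is_derive_bigsum {R : realType} {I : Type} (r : seq I)
    {h : I -> R -> R} {dh : I -> R} {t : R} :
  (forall i, is_derive t 1 (h i) (dh i)) ->
  is_derive t 1 (fun s => \sum_(i <- r) h i s) (\sum_(i <- r) dh i).
Proof.
move=> dhP; elim: r => [|i r IH].
  rewrite big_nil (_ : (fun s => _) = cst 0); first exact: is_derive_cst.
  by apply/funext => s; rewrite big_nil.
rewrite big_cons (_ : (fun s => _) = h i + fun s => \sum_(j <- r) h j s).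
  exact: is_deriveD.
by apply/funext => s; rewrite big_cons.
Qed.

Lemma is_derive_sum_mulr {R : realType} {r} (g : 'I_r -> R -> R) (c : 'I_r -> R)
    (t : R) :
  (forall i, derivable (g i) t 1) ->
  is_derive t 1 (fun s => \sum_(i < r) g i s * c i)
    (\sum_(i < r) derive1 (g i) t * c i).
Proof.
move=> dg; apply: is_derive_bigsum => i.
have := is_deriveZ (c i) (derivableP (dg i)); rewrite -derive1E mulrC.
by congr is_derive; apply/funext => s; rewrite mulrC.
Qed.

Lemma is_derive_box_integral {R : realType} {n} {lo hi : 'rV[R]_n}
    {P : set (mpoly n R)} {f : R -> 'rV[R]_n -> R} {t : R} :
  finite_dim_space P ->
  (\forall s \near t, exists2 p, P p &
     forall z, obox lo hi z -> f s z = meval (z 0) p) ->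
  (forall z, obox lo hi z -> derivable (fun s => f s z) t 1) ->
  is_derive t 1 (fun s => box_integral lo hi (f s))
    (box_integral lo hi (fun z => derive1 (fun s => f s z) t)).
Proof.
move=> [k [b ->]] Pf df.
have [r [z [phi [Xz zphi]]]] := polynomial_sampling (obox lo hi) b.
(* The points [z i] and polynomials [phi i] do not depend on [s]: time enters only through the
   finitely many values [f s (z i)]. *)
have fE : \forall s \near t, forall x, obox lo hi x ->
    f s x = \sum_(i < r) f s (z i) * meval (x 0) (phi i).
  near=> s => x Xx.
  have [_ [c ->] fs] : exists2 p, [set p | exists c : 'I_k -> R,
      p = \sum_i c i *: b i] p & forall y, obox lo hi y -> f s y = meval (y 0) p.
    by near: s.
  rewrite fs // meval_sumZ.
  under eq_bigr do rewrite zphi // mulr_sumr.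
  rewrite exchange_big; apply: eq_bigr => i _; rewrite fs // meval_sumZ mulr_suml.
  by apply: eq_bigr => j _; rewrite mulrA.
(* Used twice: with [c i] the value of [phi i] at a point, for the derivative of [f], and with [c i]
   the integral of [phi i], for the derivative of the integral. *)
have dzphi (c : 'I_r -> R) := is_derive_sum_mulr
  (fun i s => f s (z i)) c t (fun i => df _ (Xz i)).
have dfE x : obox lo hi x -> derive1 (fun s => f s x) t =
    \sum_(i < r) derive1 (fun s => f s (z i)) t * meval (x 0) (phi i).
  move=> Xx; rewrite derive1E; apply: derive_val.
  apply: near_eq_is_derive (dzphi _).
  by apply: filterS fE => s ->.
rewrite (box_integral_congr dfE) box_integral_meval_sum.
apply: near_eq_is_derive (dzphi _); apply: filterS fE => s fsE.
by rewrite (box_integral_congr fsE) box_integral_meval_sum.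
Unshelve. all: by end_near. Qed.

(** * The scheme tested with a constant, and conservation *)

Lemma inner_trace_cst {R : realType} (c : R) d s z :
  inner_trace (cst c : 'rV[R]_(3 + 3) -> R^o) d s z = c.
Proof. exact: lim_cst. Qed.

Lemma dot_gradient_cst {R : realType} n (c : R) (z u : 'rV[R]_n) :
  dot (gradient (cst c) z) u = 0.
Proof.
by rewrite /dot big1 // => i _; rewrite mxE derive_cst mul0r.
Qed.

Lemma dg_scheme_mass {R : realType} {Tx Tv : mesh R 3}
    {P : set (mpoly (3 + 3) R)} {periodic : bool} {q m : R}
    {E B : R -> 'rV[R]_3 -> 'rV[R]_3} {f : R -> 'rV[R]_(3 + 3) -> R} {t : R}
    (j : pcell Tx Tv) :
  P (mpolyC (3 + 3) 1) -> dg_scheme Tx Tv P periodic q m E B f t ->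
  cell_integral j (fun z => derive1 (fun s => f s z) t) =
  - boundary_integral j
      (num_flux Tx Tv periodic (alpha q m (E t) (B t)) (f t)).
Proof.
move=> P1; have Vh1 : in_Vh Tx Tv P (cst 1).
  by move=> i; exists (mpolyC (3 + 3) 1) => // z _; rewrite mevalC.
move=> /(_ j (cst 1) Vh1).
(* The volume term contains the gradient of the constant test function. *)
rewrite [X in _ - X](_ : _ = 0); last first.
  rewrite /cell_integral (box_integral_congr (h := fun=> 0)) => [|z _].
    by rewrite /box_integral Rintegral_cst ?mul0r //; exact: measurable_obox.
  exact: dot_gradient_cst.
rewrite subr0 => /eqP; rewrite addr_eq0 => /eqP mass.
rewrite /cell_integral.
rewrite (box_integral_congr (h := fun z => cst 1 z * derive1 (f ^~ z) t)).
  rewrite [LHS]mass; congr (- boundary_integral _ _).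
  apply/funext => d; apply/funext => s; apply/funext => z.
  by rewrite inner_trace_cst mul1r.
by move=> z _; rewrite mul1r.
Qed.

Theorem proposition6 (R : realType) (Tx Tv : mesh R 3)
    (P : set (mpoly (3 + 3) R)) (q m : R) (periodic : bool) (I : set R)
    (E B : R -> 'rV[R]_3 -> 'rV[R]_3) (f : R -> 'rV[R]_(3 + 3) -> R) :
  finite_dim_space P ->
  (forall c : R, P (mpolyC (3 + 3) c)) ->
  0 < m ->
  open I ->
  (forall t, I t -> forall k : 'I_3,
     piecewise_polynomial Tx (fun x => E t x 0 k) /\
     piecewise_polynomial Tx (fun x => B t x 0 k)) ->
  (forall t, I t -> in_Vh Tx Tv P (f t)) ->
  (forall t, I t -> forall (j : pcell Tx Tv) z, obox (lo j) (hi j) z ->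
     derivable (fun s => f s z) t 1) ->
  (~~ periodic -> forall t, I t -> vanishes_on_config_boundary Tx Tv (f t)) ->
  (forall t, I t -> dg_scheme Tx Tv P periodic q m E B f t) ->
  forall t, I t -> is_derive t 1 (fun s => particle_number Tx Tv (f s)) 0.
Proof.
move=> finP P_cst _ openI _ fVh df _ scheme t It.
pose dN := \sum_(j : pcell Tx Tv)
  cell_integral j (fun z => derive1 (fun s => f s z) t).
have -> : 0 = dN.
  rewrite /dN (eq_bigr _ (fun j _ => dg_scheme_mass j (P_cst 1) (scheme t It))).
  by rewrite sumrN sum_boundary_flux oppr0.
have dcell (j : pcell Tx Tv) : is_derive t 1 (fun s => cell_integral j (f s))
    (cell_integral j (fun z => derive1 (fun s => f s z) t)).
  apply: is_derive_box_integral finP _ (df t It j).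
  (* Since [I] is open, [f s] lies in the discrete space for all [s] near [t]. *)
  by apply: filterS (open_nbhs_nbhs (conj openI It)) => s /fVh.
exact: is_derive_bigsum.
Qed.
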